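(* Let $P,Q\in\mathbb{C}[x,y]$ be relatively prime and let $\mathcal{X}=P(x,y)\frac{\partial}{\partial x}+Q(x,y)\frac{\partial}{\partial y}$. Let $F(x,y)\in\mathbb{C}[x,y]\setminus\mathbb{C}$ with $F_y\not\equiv0$, given by $$F(x,y)=\left\{\mu(x)\prod_{j=1}^{N}\{y-y_j(x)\}\right\}_{+},$$ where $\mu(x)\in\mathbb{C}[x]$ and $y_1(x),\ldots,y_N(x)$ are pairwise distinct Puiseux series in a neighborhood of the point $x=\infty$ that satisfy the equation $P(x,y)y_x-Q(x,y)=0$, be an irreducible invariant algebraic curve of the vector field $\mathcal{X}$ and the related dynamical system $x_t=P(x,y)$, $y_t=Q(x,y)$. Then the cofactor $\lambda(x,y)$ of $F(x,y)$ takes the form $$\lambda(x,y)=\left\{P(x,y)\sum_{m=0}^{\infty}\sum_{l=1}^{L}\frac{\nu_l x_l^m}{x^{m+1}}+\sum_{m=0}^{\infty}\sum_{j=1}^{N}\frac{\{Q(x,y)-P(x,y)\,y_{j,x}\}\,y_j^m}{y^{m+1}}\right\}_{+},$$ where $x_1,\ldots,x_L$ are the pairwise distinct zeros of the polynomial $\mu(x)$ with multiplicities $\nu_1,\ldots,\nu_L\in\mathbb{N}$ and $L\in\mathbb{N}\cup\{0\}$. If $\mu(x)=\mu_0$ with $\mu_0\in\mathbb{C}$, then $L=0$ and the first series is absent.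
   Context: A polynomial $F\in\mathbb{C}[x,y]\setminus\mathbb{C}$ is called an invariant algebraic curve of $\mathcal{X}$ if $P F_x+Q F_y=\lambda F$ for some polynomial $\lambda\in\mathbb{C}[x,y]$; $\lambda$ is called the cofactor of $F$. It is irreducible if $F$ is irreducible in $\mathbb{C}[x,y]$. A Puiseux series in a neighborhood of $x=\infty$ is a series $y(x)=\sum_{l=0}^{\infty}c_l x^{(l_0-l)/n_0}$ with $l_0\in\mathbb{Z}$, $n_0\in\mathbb{N}$, $c_l\in\mathbb{C}$; $y_{j,x}$ denotes the derivative of $y_j$ with respect to $x$. For a formal sum $W(x,y)$ of monomials $c\,x^{q_1}y^{q_2}$ with $c\in\mathbb{C}$ and with degrees bounded from above, i.e. $q_1,q_2\in\mathbb{Q}$, $q_1+q_2\le K$, the projection $\{W(x,y)\}_+$ denotes the sum of the monomials of $W(x,y)$ with integer non-negative powers, $q_1,q_2\in\mathbb{N}\cup\{0\}$; in other words, $\{W(x,y)\}_+$ is the polynomial part of $W(x,y)$.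
   Formalization: Adds that each series y_j is a root of F, i.e. F(x,y_j(x))=0; without it the claim fails, e.g. P=-2x, Q=y+xy^2, F=y, mu=1, y_1=1/x, where the cofactor is 1+xy but the formula gives 2+xy. *)

(* Defs.v *)
From HB Require Import structures.
From mathcomp Require Import all_boot all_order all_algebra.
From mathcomp Require Import complex.
From mathcomp Require Import mathcomp_extra boolp classical_sets functions.
From mathcomp Require Import fsbigop reals.
Set Implicit Arguments.
Unset Strict Implicit.
Unset Printing Implicit Defensive.
Import Order.TTheory GRing.Theory Num.Theory.
Local Open Scope classical_set_scope.
Local Open Scope ring_scope.

(* K[x,y] is {poly {poly K}}: the inner variable is x, the outer one is y, so
   that the units of {poly {poly K}} are the nonzero constants of K. *)

Definition dx (K : fieldType) (F : {poly {poly K}}) : {poly {poly K}} :=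
  map_poly (@deriv K) F.

Definition dy (K : fieldType) (F : {poly {poly K}}) : {poly {poly K}} :=
  F^`().

(* The library's coprimep and irreducible_poly, used at {poly {poly K}}, ignore
   factors that depend on x only; these are the notions of K[x,y] itself. *)

Definition relatively_prime (A : idomainType) (P Q : A) : Prop :=
  forall D U V : A, P = D * U -> Q = D * V -> D \is a GRing.unit.

Definition irreducible (A : idomainType) (F : A) : Prop :=
  [/\ F != 0, F \isn't a GRing.unit &
      forall U V : A, F = U * V ->
        U \is a GRing.unit \/ V \is a GRing.unit].

Definition is_cofactor (K : fieldType) (P Q F lam : {poly {poly K}}) : Prop :=
  P * dx F + Q * dy F = lam * F.

Definition invariant_curve (K : fieldType) (P Q F : {poly {poly K}}) : Prop :=
  (forall c : K, F <> c%:P%:P) /\ exists lam, is_cofactor P Q F lam.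

(* A formal sum of monomials c x^q1 y^q2 with rational exponents is given by its
   coefficients: W (q1, q2) is the coefficient of x^q1 y^q2. *)
Definition fsum (K : fieldType) : Type := rat * rat -> K.

HB.instance Definition _ (K : fieldType) :=
  GRing.Zmodule.copy (fsum K) (rat * rat -> K).

Definition fmono (K : fieldType) (c : K) (q1 q2 : rat) : fsum K :=
  fun q => if q == (q1, q2) then c else 0.

Definition fone (K : fieldType) : fsum K := fmono 1 0 0.

(* Cauchy product. The sum over p is the sum of a finitely supported family (its
   value is 0 if the support is infinite); the supports of the factors used
   below always make it finite. *)
Definition fmul (K : fieldType) (V W : fsum K) : fsum K :=
  fun q => \sum_(p \in [set: rat * rat]) (V p * W (q - p)).

Definition fpow (K : fieldType) (W : fsum K) (m : nat) : fsum K :=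
  iter m (fmul W) (fone K).

(* The series \sum_(m >= 0) T m of formal sums, computed coefficientwise: each
   monomial occurs in finitely many T m, with the same convention as for fmul. *)
Definition fseries (K : fieldType) (T : nat -> fsum K) : fsum K :=
  fun q => \sum_(m \in [set: nat]) T m q.

Definition fdx (K : fieldType) (W : fsum K) : fsum K :=
  fun q => ratr (q.1 + 1) * W (q.1 + 1, q.2).

Definition fpoly (K : fieldType) (F : {poly {poly K}}) : fsum K :=
  \sum_(k < size F) \sum_(i < size F`_k) fmono F`_k`_i i%:R k%:R.

(* The projection {W}_+. *)
Definition fplus (K : fieldType) (W : fsum K) : fsum K :=
  fun q => if (q.1 \is a Num.nat) && (q.2 \is a Num.nat) then W q else 0.

Definition puiseux_infty (K : fieldType) (s : fsum K) : Prop :=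
  exists (l0 : int) (n0 : nat) (c : nat -> K), (0 < n0)%N /\
    s = fseries (fun l => fmono (c l) ((l0%:~R - l%:R) / n0%:R) 0).

(* F(x, s(x)) *)
Definition fsubst (K : fieldType) (F : {poly {poly K}}) (s : fsum K) : fsum K :=
  \sum_(k < size F) fmul (fpoly (F`_k)%:P) (fpow s k).

(* s satisfies P(x,y) y_x - Q(x,y) = 0 *)
Definition solves_ode (K : fieldType) (P Q : {poly {poly K}}) (s : fsum K) :
    Prop :=
  fmul (fsubst P s) (fdx s) - fsubst Q s = 0.

(* mu(x) * \prod_j (y - y_j(x)) *)
Definition puiseux_product (K : fieldType) (mu : {poly K}) (N : nat)
    (y : 'I_N -> fsum K) : fsum K :=
  fmul (fpoly mu%:P) (\big[@fmul K / fone K]_(j < N) (fmono 1 0 1 - y j)).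

(* \sum_(m >= 0) \sum_l nu_l x_l^m / x^(m+1) *)
Definition zeros_series (K : fieldType) (L : nat) (x : 'I_L -> K)
    (nu : 'I_L -> nat) : fsum K :=
  fseries (fun m => \sum_(l < L) fmono ((nu l)%:R * x l ^+ m) (- m.+1%:R) 0).

(* \sum_(m >= 0) \sum_j {Q(x,y) - P(x,y) y_(j,x)} y_j^m / y^(m+1) *)
Definition branches_series (K : fieldType) (P Q : {poly {poly K}}) (N : nat)
    (y : 'I_N -> fsum K) : fsum K :=
  fseries (fun m => \sum_(j < N)
    fmul (fmul (fpoly Q - fmul (fpoly P) (fdx (y j))) (fpow (y j) m))
         (fmono 1 0 (- m.+1%:R))).

(* Main.v *)
Require Import Defs.
From HB Require Import structures.
From mathcomp Require Import all_boot all_order all_algebra.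
From mathcomp Require Import complex finmap.
From mathcomp Require Import boolp classical_sets.
From mathcomp Require Import fsbigop reals.
From mathcomp Require Import ring lra zify.
Set Implicit Arguments.
Unset Strict Implicit.
Unset Printing Implicit Defensive.
Import Order.TTheory GRing.Theory Num.Theory.
Local Open Scope ring_scope.

(** The cofactor is the logarithmic derivative of F along the vector field, and
    the formula is its decomposition over the factors of F.

    Polynomials, Puiseux series and the expansions of 1 / (x - x_l) at infinity
    have their exponents on a grid (1/n)Z x (1/n)Z, bounded above. Such sums form an integral domain
    ([gsum]), because products are finite convolutions and the lexicographically
    largest monomials of two factors multiply without cancellation; d/dx is a
    derivation of it ([gder]). The coefficient of y^N in the product of mu and
    the y - y_j is mu, and no higher power of y occurs, so the hypothesis on the
    projection says that F has degree N in y and leading coefficient mu. The N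
    distinct branches are roots of F, hence F = mu * \prod_j (y - y_j) exactly
    ([projection_factored]).

    The vector field acts as a derivation E = P d/dx + Q d/dy with E F = lam F,
    and E f / f turns products into sums, so after cancelling F

      lam = P mu' / mu + \sum_j (Q - P y_j') / (y - y_j)

    ([cofactor_expansion]). Here mu' / mu = \sum_l nu_l / (x - x_l), and each
    1 / (x - x_l) is a geometric series in 1/x ([ginvxP], [gder_gpoly_zeros]).
    In the second sum the numerator vanishes at y = y_j, since y_j solves the
    differential equation, so the quotient is a polynomial in y. By synthetic
    division its coefficient at y^k is \sum_m G_(k+m+1) y_j^m, where G_i are the
    coefficients of the numerator; this is also what the series
    \sum_m G y_j^m / y^(m+1) contributes to y^k for k >= 0
    ([synthetic_division_coef], [branches_seriesE]). Its monomials
    with a negative power of y are discarded by the projection. *)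

(** * Supports on a grid and finiteness of convolutions *)

Definition grid_point (n A a b : nat) : rat * rat :=
  ((A%:R - a%:R) / n%:R, (A%:R - b%:R) / n%:R).

Definition on_grid (n A : nat) (q : rat * rat) : Prop :=
  exists a b : nat, q = grid_point n A a b.

Definition supported (K : fieldType) (n A : nat) (W : fsum K) : Prop :=
  forall q, W q != 0 -> on_grid n A q.

(** The bound A serves both variables, and A and n can be increased at will
    ([on_grid_refine]), so finitely many admissible sums share one grid. *)
Definition admissible (K : fieldType) (W : fsum K) : Prop :=
  exists n A : nat, (0 < n)%N /\ supported n A W.

Lemma on_grid_refine (n A m B : nat) q : (0 < n)%N -> (0 < m)%N ->
  on_grid n A q -> on_grid (n * m) (A * m + B) q.
Proof.
move=> n0 m0 [a [b ->]]; exists (a * m + B)%N, (b * m + B)%N.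
have ? : (n%:R : rat) != 0 by rewrite pnatr_eq0 -lt0n.
have ? : (m%:R : rat) != 0 by rewrite pnatr_eq0 -lt0n.
by rewrite /grid_point !natrD !natrM; congr pair; field; apply/andP.
Qed.

Lemma on_grid_add (n A B : nat) p q :
  on_grid n A p -> on_grid n B q -> on_grid n (A + B) (p + q).
Proof.
move=> [a [b ->]] [a' [b' ->]]; exists (a + a')%N, (b + b')%N.
by rewrite /grid_point !natrD; congr pair; rewrite /= -mulrDl; congr (_ / _);
  ring.
Qed.

Lemma supported_refine (K : fieldType) n A m B (W : fsum K) :
  (0 < n)%N -> (0 < m)%N -> supported n A W -> supported (n * m) (A * m + B) W.
Proof. by move=> n0 m0 sW q /sW; apply: on_grid_refine. Qed.

Lemma common_grid (K : fieldType) (V W : fsum K) :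
  admissible V -> admissible W ->
  exists n A : nat, [/\ (0 < n)%N, supported n A V & supported n A W].
Proof.
move=> [n [A [n0 sV]]] [m [B [m0 sW]]].
exists (n * m)%N, (A * m + B * n)%N; split; first by rewrite muln_gt0 n0.
- exact: supported_refine.
- by rewrite mulnC addnC; apply: supported_refine.
Qed.

Lemma common_grid3 (K : fieldType) (U V W : fsum K) :
  admissible U -> admissible V -> admissible W ->
  exists n A : nat, [/\ (0 < n)%N, supported n A U, supported n A V
    & supported n A W].
Proof.
move=> [n [A [n0 sU]]] aV aW; have [m [B [m0 sV sW]]] := common_grid aV aW.
exists (n * m)%N, (A * m + B * n)%N; split; first by rewrite muln_gt0 n0.
- exact: supported_refine.
- by rewrite mulnC addnC; apply: supported_refine.
- by rewrite mulnC addnC; apply: supported_refine.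
Qed.

(** Finiteness of the convolution: if p and q - p both lie on the grid below A,
    the indices of p are bounded by those of q, since the two pairs of indices
    have a constant sum. *)
Lemma grid_window (n A : nat) (q : rat * rat) : (0 < n)%N ->
  exists r : {fset rat * rat}, forall p, on_grid n A p -> on_grid n A (q - p) ->
    p \in r.
Proof.
move=> n0; have nN0 : (n%:R : rat) != 0 by rewrite pnatr_eq0 -lt0n.
(* One decomposition of q, if there is any, fixes that constant sum. *)
have [[p0 [[a0 [b0 p0E]] [c0 [d0 q0E]]]]|none] :=
  pselect (exists p, on_grid n A p /\ on_grid n A (q - p)); last first.
  by exists fset0 => p p1 p2; case: none; exists p.
exists [fset grid_point n A ab.1 ab.2
         | ab in [seq (a, b) | a <- iota 0 (a0 + c0).+1,
                              b <- iota 0 (b0 + d0).+1]]%fset.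
move=> _ [a [b ->]] [c [d qE]].
have E : grid_point n A a b + grid_point n A c d =
         grid_point n A a0 b0 + grid_point n A c0 d0.
  by rewrite -qE -q0E -p0E !(addrC _ (q - _)) !subrK.
have idx u v u0 v0 :
    ((A%:R - u%:R) / n%:R + (A%:R - v%:R) / n%:R : rat) =
    (A%:R - u0%:R) / n%:R + (A%:R - v0%:R) / n%:R -> (u < (u0 + v0).+1)%N.
  rewrite -!mulrDl => /(mulIf _) H.
  have {}H : (u + v)%:R = (u0 + v0)%:R :> rat.
    by rewrite !natrD; have := H (invr_neq0 nN0); lra.
  by have /eqP := H; rewrite eqr_nat => /eqP <-; rewrite ltnS leq_addr.
apply/imfsetP; exists (a, b) => //; apply: allpairs_f.
- by rewrite mem_iota; apply: (idx _ _ _ _ (congr1 fst E)).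
- by rewrite mem_iota; apply: (idx _ _ _ _ (congr1 snd E)).
Qed.

(** * The convolution product *)

Section Convolution.
Variable K : fieldType.
Implicit Types U V W : fsum K.

Lemma fsumDE V W q : (V + W) q = V q + W q. Proof. by []. Qed.

Lemma fsumNE V q : (- V) q = - V q. Proof. by []. Qed.

(** The sum defining [fmul] can be taken over any finite set that contains the
    nonzero terms; a set common to several products makes them comparable. *)
Lemma fmul_window V W q (r : {fset rat * rat}) :
  (forall p, V p != 0 -> W (q - p) != 0 -> p \in r) ->
  fmul V W q = \sum_(p <- r) V p * W (q - p).
Proof.
move=> H; apply: fsbigTE => p pr; apply/eqP; apply: contraNT pr.
by rewrite mulf_eq0 negb_or => /andP[/H].
Qed.

Lemma fmulC V W : fmul V W = fmul W V.
Proof.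
apply/funext => q; rewrite /fmul (reindex_fsbigT (fun p => q - p)); last first.
  by exists (fun p => q - p) => p; rewrite subKr.
by apply: eq_fsbigr => p _; rewrite subKr mulrC.
Qed.

Lemma fmul_monol c q1 q2 W q :
  fmul (fmono c q1 q2) W q = c * W (q - (q1, q2)).
Proof.
rewrite (@fmul_window _ _ _ [fset (q1, q2)]%fset) => [|p].
  by rewrite big_seq_fset1 /fmono eqxx.
by rewrite /fmono inE; case: ifP => //; rewrite eqxx.
Qed.

Lemma fmul1 W : fmul (fone K) W = W.
Proof.
by apply/funext => q; rewrite fmul_monol mul1r; congr (W _); rewrite subr0.
Qed.

Lemma supported_fmul n A V W : supported n A V -> supported n A W ->
  supported n (A + A) (fmul V W).
Proof.
move=> sV sW q; apply: contra_neqP => gridN; apply: fsbig1 => p _; apply/eqP.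
apply: contra_notT gridN; rewrite mulf_eq0 negb_or => /andP[/sV Vp /sW Wp].
by rewrite -(subrK p q) addrC; apply: on_grid_add.
Qed.

Lemma admissible_fmul V W : admissible V -> admissible W ->
  admissible (fmul V W).
Proof.
move=> aV aW; have [n [A [n0 sV sW]]] := common_grid aV aW.
by exists n, (A + A)%N; split=> //; apply: supported_fmul.
Qed.

Lemma admissible_fmono c (q1 q2 : int) :
  admissible (fmono c q1%:~R q2%:~R : fsum K).
Proof.
exists 1, (`|q1| + `|q2|)%N; split=> // q; rewrite /fmono.
case: ifP => [/eqP -> _|_]; last by rewrite eqxx.
exists `|(`|q1| + `|q2|)%N%:Z - q1|%N, `|(`|q1| + `|q2|)%N%:Z - q2|%N.
rewrite /grid_point !natr_absz !ger0_norm; try lia.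
by congr pair; rewrite divr1 rmorphB /= opprB addrC subrK.
Qed.

Lemma admissible0 : admissible (0 : fsum K).
Proof. by exists 1, 0; split=> // q /eqP. Qed.

Lemma admissibleD V W : admissible V -> admissible W -> admissible (V + W).
Proof.
move=> aV aW; have [n [A [n0 sV sW]]] := common_grid aV aW.
exists n, A; split=> // q; have [V0|/sV//] := eqVneq (V q) 0.
by rewrite fsumDE V0 add0r => /sW.
Qed.

Lemma admissibleN V : admissible V -> admissible (- V).
Proof.
by move=> [n [A [n0 sV]]]; exists n, A; split=> // q; rewrite oppr_eq0 => /sV.
Qed.

Lemma fmulDl U V W : admissible U -> admissible V -> admissible W ->
  fmul (U + V) W = fmul U W + fmul V W.
Proof.
move=> aU aV aW; apply/funext => q.
have [n [A [n0 sU sV sW]]] := common_grid3 aU aV aW.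
have [r rP] := grid_window A q n0.
have in_r (Z : fsum K) p : supported n A Z -> Z p != 0 -> W (q - p) != 0 ->
  p \in r by move=> sZ /sZ Zp /sW Wp; apply: rP.
have sUV : supported n A (U + V).
  move=> p; have [U0|/sU//] := eqVneq (U p) 0.
  by rewrite fsumDE U0 add0r => /sV.
rewrite fsumDE !(@fmul_window _ _ q r); try by move=> p; apply: in_r.
by rewrite -big_split; apply: eq_bigr => p _; rewrite fsumDE mulrDl.
Qed.

(** Associativity is an exchange of two finite sums, over a window large enough
    for both bracketings. *)
Lemma fmulA U V W : admissible U -> admissible V -> admissible W ->
  fmul U (fmul V W) = fmul (fmul U V) W.
Proof.
move=> aU aV aW; apply/funext => q.
have [n [A [n0 sU sV sW]]] := common_grid3 aU aV aW.
have [r rP] := grid_window (A + A) q n0.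
have wide p : on_grid n A p -> on_grid n (A + A) p.
  by move=> gp; have := @on_grid_refine n A 1 A p n0 isT gp; rewrite !muln1.
have split1 p s : q - p = (s - p) + (q - s) by rewrite [RHS]addrC addrA subrK.
rewrite (@fmul_window _ _ q r) => [|p Up /(supported_fmul sV sW)]; last first.
  by apply: rP; apply/wide/sU.
rewrite (@fmul_window (fmul U V) _ q r) => [|s /(supported_fmul sU sV) UVs Ws];
  last by apply: rP => //; apply/wide/sW.
(* Inner sums are recentred at s = p + u, so that both sides run over the same
   pairs (p, s). *)
under eq_bigr => p _.
  rewrite mulr_fsumr (reindex_fsbigT (fun s => s - p)); last first.
    by exists (fun s => s + p) => s; rewrite ?subrK ?addrK.
  rewrite (fsbigTE r) => [|s sr]; last first.
    apply/eqP; apply: contraNT sr; rewrite opprB [q - p + _]addrA subrK.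
    rewrite !mulf_eq0 !negb_or => /and3P[/sU Up /sV VV /sW WW].
    apply: rP; last exact: wide.
    by rewrite -(subrK p s) addrC; apply: on_grid_add.
  under eq_bigr => s _ do rewrite opprB [q - p + _]addrA subrK mulrA.
  over.
rewrite exchange_big /= !big_seq; apply: eq_bigr => s sr.
rewrite -mulr_suml; have [->|WN0] := eqVneq (W (q - s)) 0.
  by rewrite !mulr0.
congr (_ * _); rewrite (@fmul_window _ _ s r) // => p /sU Up /sV VV.
apply: rP; first exact: wide.
by rewrite (split1 p s); apply: on_grid_add => //; apply: sW.
Qed.

End Convolution.

(** * The integral domain of admissible sums *)

Record gsum (K : fieldType) := Gsum {
  gval :> fsum K;
  gsumP : `[< admissible gval >] }.

Section GridSums.
Variable K : fieldType.

HB.instance Definition _ := [isSub for @gval K].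
HB.instance Definition _ := [Choice of gsum K by <:].

Implicit Types f g h : gsum K.

Lemma gsum_admissible f : admissible f.
Proof. exact/asboolP/gsumP. Qed.

Definition mk_gsum (W : fsum K) (aW : admissible W) : gsum K :=
  Gsum (introT (asboolP _) aW).

Definition g0 := mk_gsum (@admissible0 K).
Definition g1 : gsum K := mk_gsum (@admissible_fmono K 1 0 0).
Definition gadd f g :=
  mk_gsum (admissibleD (gsum_admissible f) (gsum_admissible g)).
Definition gopp f := mk_gsum (admissibleN (gsum_admissible f)).
Definition gmul f g :=
  mk_gsum (admissible_fmul (gsum_admissible f) (gsum_admissible g)).

Fact gaddA : associative gadd.
Proof. by move=> f g h; apply/val_inj/addrA. Qed.
Fact gaddC : commutative gadd.
Proof. by move=> f g; apply/val_inj/addrC. Qed.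
Fact gadd0 : left_id g0 gadd.
Proof. by move=> f; apply/val_inj/add0r. Qed.
Fact gaddN : left_inverse g0 gopp gadd.
Proof. by move=> f; apply/val_inj/addNr. Qed.

HB.instance Definition _ :=
  GRing.isZmodule.Build (gsum K) gaddA gaddC gadd0 gaddN.

Fact gmulA : associative gmul.
Proof. by move=> f g h; apply/val_inj/fmulA; apply: gsum_admissible. Qed.
Fact gmulC : commutative gmul.
Proof. by move=> f g; apply/val_inj/fmulC. Qed.
Fact gmul1 : left_id g1 gmul.
Proof. by move=> f; apply/val_inj/fmul1. Qed.
Fact gmulDl : left_distributive gmul gadd.
Proof. by move=> f g h; apply/val_inj/fmulDl; apply: gsum_admissible. Qed.
Fact g1_neq0 : g1 != 0.
Proof.
apply/eqP => /(congr1 (fun f : gsum K => gval f (0, 0))) /eqP.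
by rewrite /= /fmono eqxx oner_eq0.
Qed.

HB.instance Definition _ :=
  GRing.Zmodule_isComNzRing.Build (gsum K) gmulA gmulC gmul1 gmulDl g1_neq0.

Lemma gval_inj : injective (@gval K). Proof. exact: val_inj. Qed.

Lemma gvalM f g : gval (f * g) = fmul f g. Proof. by []. Qed.

Lemma gval1 : gval 1 = fone K. Proof. by []. Qed.

Lemma gvalD f g : gval (f + g) = gval f + gval g. Proof. by []. Qed.

Fact gval_additive : zmod_morphism (@gval K). Proof. by []. Qed.
HB.instance Definition _ :=
  GRing.isZmodMorphism.Build (gsum K) (fsum K) (@gval K) gval_additive.

Lemma gvalX f m : gval (f ^+ m) = fpow f m.
Proof. by elim: m => // m IHm; rewrite exprS gvalM IHm. Qed.

(** The leading monomial, where powers of y are compared first. *)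
Definition lex_top f (t : rat * rat) : Prop :=
  gval f t != 0 /\
  forall p, gval f p != 0 -> p.2 <= t.2 /\ (p.2 = t.2 -> p.1 <= t.1).

(** The grid indices of a support are natural numbers that decrease as the
    exponents increase, so the largest exponents come from minimal indices. *)
Lemma ex_lex_top f : f != 0 -> exists t, lex_top f t.
Proof.
move=> fN0; have [n [A [n0 sf]]] := gsum_admissible f.
have [p fp] : exists p, gval f p != 0.
  apply: contrapT => none; case/eqP: fN0; apply/gval_inj/funext => p.
  by apply/eqP; apply: contraT => fp; case: none; exists p.
have [a1 [b1 pE]] := sf p fp; rewrite {p}pE in fp.
have exb : exists b, `[< exists a, gval f (grid_point n A a b) != 0 >].
  by exists b1; apply/asboolP; exists a1.
case: (ex_minnP exb) => b /asboolP [a2 fa2] b_min.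
have exa : exists a, gval f (grid_point n A a b) != 0 by exists a2.
case: (ex_minnP exa) => a fa a_min.
have mono (u v : nat) : ((A%:R - u%:R) / n%:R <= (A%:R - v%:R) / n%:R :> rat) =
    (v <= u)%N.
  by rewrite ler_pM2r ?invr_gt0 ?ltr0n// lerD2l lerN2 ler_nat.
exists (grid_point n A a b); split=> // {}p {}fp.
have [c [d pE]] := sf p fp; rewrite {p}pE in fp *; rewrite /= !mono.
split; first by apply/b_min/asboolP; exists c.
move=> /eqP; rewrite eq_le !mono => /andP[bd db].
have dE : d = b by apply/eqP; rewrite eqn_leq db bd.
by apply: a_min; rewrite -dE.
Qed.

(** Only s and t themselves can be exponents of f and g that add up to s + t. *)
Lemma lex_top_mul f g s t : lex_top f s -> lex_top g t ->
  gval (f * g) (s + t) = gval f s * gval g t.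
Proof.
move=> [fs fmax] [gt gmax]; rewrite gvalM (@fmul_window _ _ _ _ [fset s]%fset).
  by rewrite big_seq_fset1 addrC addKr.
move=> p /fmax [p2 p1] /gmax [/= q2 q1]; rewrite inE.
have E2 : p.2 = s.2 by move: p2 q2; rewrite /=; lra.
have E1 : p.1 = s.1.
  by move: (p1 E2) q1; rewrite E2 addrC addKr => ? /(_ erefl); lra.
by rewrite -pair_eqE /= /pair_eq /= E1 E2 !eqxx.
Qed.

(** Units and inverses by choice: integral domains are required to come with
    them. *)
Definition gunit : {pred gsum K} := fun f => `[< exists g, g * f = 1 >].
Definition ginv f : gsum K :=
  if pselect (exists g, g * f = 1) is left ex then projT1 (cid ex) else f.

Fact gmulV : {in gunit, left_inverse 1 ginv *%R}.
Proof.
move=> f /asboolP uf; rewrite /ginv; case: pselect => // ex.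
exact: projT2 (cid ex).
Qed.
Fact gunitPl f g : g * f = 1 -> gunit f.
Proof. by move=> E; apply/asboolP; exists g. Qed.
Fact ginv_out : {in [predC gunit], ginv =1 id}.
Proof.
move=> f nuf; rewrite /ginv; case: pselect => // ex.
by case/negP: nuf; apply/asboolP.
Qed.

HB.instance Definition _ :=
  GRing.ComNzRing_hasMulInverse.Build (gsum K) gmulV gunitPl ginv_out.

Fact gmul_eq0 f g : f * g = 0 -> (f == 0) || (g == 0).
Proof.
move=> fg0; apply: contraT; rewrite negb_or => /andP[].
move=> /ex_lex_top [s tops] /ex_lex_top [t topt].
have := lex_top_mul tops topt; rewrite fg0 => /esym/eqP.
by rewrite mulf_eq0 (negbTE tops.1) (negbTE topt.1).
Qed.

HB.instance Definition _ :=
  GRing.ComUnitRing_isIntegral.Build (gsum K) gmul_eq0.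

End GridSums.

(** * The derivation with respect to x *)

Section Derivation.
Variable K : numFieldType.
Implicit Types V W : fsum K.

Lemma admissible_fdx W : admissible W -> admissible (fdx W).
Proof.
move=> [n [A [n0 sW]]]; exists n, A; split=> // -[q1 q2].
rewrite mulf_eq0 negb_or => /andP[_ /sW [a [b [/= E1 ->]]]].
exists (a + n)%N, b; congr pair.
have nN0 : (n%:R : rat) != 0 by rewrite pnatr_eq0 -lt0n.
by rewrite -[LHS](addrK 1) E1 natrD; field.
Qed.

(** Both terms on the right become sums over the same decompositions
    p + (q + e - p) = q + e, with weights p.1 and q.1 - p.1 + 1; the weights add
    up to the exponent of x that the derivative of the product brings down. *)
Lemma fdxM V W : admissible V -> admissible W ->
  fdx (fmul V W) = fmul (fdx V) W + fmul V (fdx W).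
Proof.
move=> aV aW; apply/funext => q.
have [n [A [n0 sV sW]]] := common_grid aV aW.
set e : rat * rat := (1, 0).
have shift (p : rat * rat) : (p.1 + 1, p.2) = p + e.
  by case: p => a b; congr pair; rewrite /= addr0.
have [r rP] := grid_window A (q + e) n0.
have outside p : p \notin r -> V p * W (q + e - p) = 0.
  move=> pr; apply/eqP; apply: contraNT pr.
  by rewrite mulf_eq0 negb_or => /andP[/sV Vp /sW]; apply: rP.
rewrite fsumDE {1}/fdx shift (@fmul_window _ _ _ _ r); last first.
  by move=> p /sV Vp /sW; apply: rP.
have -> : fmul (fdx V) W q =
    \sum_(p <- r) ratr p.1 * (V p * W (q + e - p)).
  rewrite /fmul (reindex_fsbigT (fun p => p - e)); last first.
    by exists (fun p => p + e) => p; rewrite ?subrK ?addrK.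
  have term p : fdx V (p - e) * W (q - (p - e)) =
      ratr p.1 * (V p * W (q + e - p)).
    rewrite /fdx shift subrK opprB addrA mulrA; congr (ratr _ * _ * _).
    by rewrite subrK.
  rewrite (fsbigTE r) => [|p pr]; last by rewrite term outside ?mulr0.
  by apply: eq_bigr => p _; rewrite term.
have -> : fmul V (fdx W) q =
    \sum_(p <- r) ratr (q.1 - p.1 + 1) * (V p * W (q + e - p)).
  have term p : V p * fdx W (q - p) =
      ratr (q.1 - p.1 + 1) * (V p * W (q + e - p)).
    by rewrite /fdx shift [q - p + e]addrAC mulrCA.
  rewrite /fmul (fsbigTE r) => [|p pr]; last by rewrite term outside ?mulr0.
  by apply: eq_bigr => p _; rewrite term.
rewrite -big_split mulr_sumr; apply: eq_bigr => p _ /=.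
by rewrite -mulrDl -rmorphD; congr (ratr _ * _); ring.
Qed.

Definition gder (f : gsum K) : gsum K :=
  mk_gsum (admissible_fdx (gsum_admissible f)).

Lemma gderM f g : gder (f * g) = gder f * g + f * gder g.
Proof. by apply/gval_inj/fdxM; apply: gsum_admissible. Qed.

Fact gder_additive : zmod_morphism gder.
Proof.
by move=> f g; apply/gval_inj/funext => q; apply: mulrBr.
Qed.
HB.instance Definition _ :=
  GRing.isZmodMorphism.Build (gsum K) (gsum K) gder gder_additive.

End Derivation.

(** * Polynomials among the formal sums *)

Section Monomials.
Variable K : fieldType.
Implicit Types (c : K) (p : {poly K}) (F : {poly {poly K}}).

Definition gmono c (a b : int) : gsum K := mk_gsum (admissible_fmono c a b).

Lemma gmonoM c d a b a' b' :
  gmono c a b * gmono d a' b' = gmono (c * d) (a + a') (b + b').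
Proof.
apply/gval_inj/funext => q; rewrite gvalM fmul_monol /= /fmono.
have -> : (q - (a%:~R, b%:~R) == (a'%:~R, b'%:~R)) =
          (q == ((a + a')%:~R, (b + b')%:~R)).
  by rewrite subr_eq addrC !rmorphD.
by case: ifP => _; rewrite ?mulr0.
Qed.

Definition gx := gmono 1 1 0.
Definition gy := gmono 1 0 1.
Definition gcst c := gmono c 0 0.

Lemma gcst_mul_xy c (i k : nat) : gcst c * gx ^+ i * gy ^+ k = gmono c i k.
Proof.
have powx : gx ^+ i = gmono 1 i 0.
  elim: i => // i IHi; rewrite exprS IHi gmonoM mul1r addr0.
  by congr gmono; rewrite -add1n PoszD.
have -> : gy ^+ k = gmono 1 0 k.
  elim: k => // k IHk; rewrite exprS IHk gmonoM mul1r addr0.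
  by congr gmono; rewrite -add1n PoszD.
by rewrite powx !gmonoM !mulr1 !add0r addr0.
Qed.

Fact gcst_additive : zmod_morphism gcst.
Proof.
move=> c d; apply/gval_inj/funext => q; rewrite raddfB /= fsumDE fsumNE /fmono.
by case: ifP => _; rewrite ?subr0.
Qed.
HB.instance Definition _ :=
  GRing.isZmodMorphism.Build K (gsum K) gcst gcst_additive.

Fact gcst_monoid_morphism : monoid_morphism gcst.
Proof. by split=> // c d; rewrite gmonoM !addr0. Qed.
HB.instance Definition _ :=
  GRing.isMonoidMorphism.Build K (gsum K) gcst gcst_monoid_morphism.

Definition gpoly : {poly K} -> gsum K := horner_eval gx \o map_poly gcst.
HB.instance Definition _ := GRing.RMorphism.on gpoly.

Lemma gpolyE p : gpoly p = \sum_(i < size p) gcst p`_i * gx ^+ i.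
Proof.
rewrite /gpoly /= /horner_eval (horner_coef_wide _ (size_poly _ _)).
by apply: eq_bigr => i _; rewrite coef_map.
Qed.

Lemma gpolyC c : gpoly c%:P = gcst c.
Proof. by rewrite /gpoly /= map_polyC /horner_eval hornerC. Qed.

Lemma gpolyX : gpoly 'X = gx.
Proof. by rewrite /gpoly /= map_polyX /horner_eval hornerX. Qed.

(** F(x, s). At s = y this is F itself as a formal sum ([gval_geval_y]), and at
    a branch it is the substitution [fsubst] ([gval_geval]). *)
Definition geval (s : gsum K) : {poly {poly K}} -> gsum K :=
  horner_eval s \o map_poly gpoly.
HB.instance Definition _ s := GRing.RMorphism.on (geval s).

Lemma gevalE s F : geval s F = \sum_(k < size F) gpoly F`_k * s ^+ k.
Proof.
rewrite /geval /= /horner_eval (horner_coef_wide _ (size_poly _ _)).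
by apply: eq_bigr => i _; rewrite coef_map.
Qed.

Lemma gval_geval_y F : gval (geval gy F) = fpoly F.
Proof.
rewrite gevalE raddf_sum; apply: eq_bigr => k _.
rewrite gpolyE mulr_suml raddf_sum; apply: eq_bigr => i _.
by rewrite gcst_mul_xy.
Qed.

Lemma gval_gpoly p : gval (gpoly p) = fpoly p%:P.
Proof. by rewrite -gval_geval_y /geval /= map_polyC /horner_eval hornerC. Qed.

Lemma gval_geval s F : gval (geval s F) = fsubst F s.
Proof.
rewrite gevalE raddf_sum; apply: eq_bigr => k _ /=.
by rewrite gvalX gval_gpoly.
Qed.

Lemma fsum_sumE (I : Type) (r : seq I) (P : pred I) (T : I -> fsum K) q :
  (\sum_(i <- r | P i) T i) q = \sum_(i <- r | P i) T i q.
Proof. by elim/big_rec2: _ => // i u v _ <-. Qed.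

Lemma gval_sumE (I : Type) (r : seq I) (P : pred I) (f : I -> gsum K) q :
  gval (\sum_(i <- r | P i) f i) q = \sum_(i <- r | P i) gval (f i) q.
Proof. by rewrite raddf_sum fsum_sumE. Qed.

Lemma fpoly_coef F (i k : nat) : fpoly F (i%:R, k%:R) = F`_k`_i.
Proof.
rewrite /fpoly fsum_sumE.
have eqn (u v : nat) : (u%:R == v%:R :> rat) = (u == v).
  by rewrite eqr_nat.
under eq_bigr do [rewrite fsum_sumE; under eq_bigr do
  rewrite /fmono -pair_eqE /pair_eq /= !eqn].
have [kF|kF] := ltnP k (size F); last first.
  rewrite (nth_default _ kF) coef0 big1 // => j _; rewrite big1 // => l _.
  by rewrite [k == j]gtn_eqF ?andbF // (leq_trans _ kF).
rewrite (bigD1 (Ordinal kF)) //= [X in _ + X]big1 => [|j jk]; last first.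
  have /negbTE kj : k != j.
    by apply: contraNneq jk => kj; apply/eqP/val_inj.
  by rewrite big1 // => l _; rewrite kj andbF.
rewrite addr0 eqxx; have [iF|iF] := ltnP i (size F`_k); last first.
  rewrite (nth_default _ iF) big1 // => l _.
  by rewrite [i == l]gtn_eqF // (leq_trans _ iF).
rewrite (bigD1 (Ordinal iF)) //= [X in _ + X]big1 => [|l li]; last first.
  have /negbTE il : i != l.
    by apply: contraNneq li => il; apply/eqP/val_inj.
  by rewrite il.
by rewrite addr0 eqxx.
Qed.

Lemma fplus_fpoly F : fplus (fpoly F) = fpoly F.
Proof.
apply/funext => q; rewrite /fplus; case: ifPn => // qN.
rewrite /fpoly fsum_sumE big1 // => k _; rewrite fsum_sumE big1 // => i _.
by rewrite /fmono; case: eqP => // E; rewrite E /= !natr_nat in qN.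
Qed.

Lemma fpoly_inj : injective (@fpoly K).
Proof.
by move=> F G FG; apply/polyP => k; apply/polyP => i; rewrite -!fpoly_coef FG.
Qed.

Lemma geval_y_inj : injective (geval gy).
Proof.
by move=> F G FG; apply: fpoly_inj; rewrite -!gval_geval_y FG.
Qed.

Lemma gyX (k : nat) : gy ^+ k = gmono 1 0 k.
Proof. by rewrite -(gcst_mul_xy 1 0 k) rmorph1 expr0 !mul1r. Qed.

Lemma gval_mul_yX f (i : nat) q :
  gval (f * gy ^+ i) q = gval f (q.1, q.2 - i%:R).
Proof.
rewrite gyX mulrC gvalM fmul_monol mul1r; congr (gval f _).
by case: q => a b; congr pair; rewrite /= subr0.
Qed.

End Monomials.

(** * Polynomials in y over the sums in x alone *)

Section XOnly.
Variable K : fieldType.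

(** The subring of sums in x alone: over it, the coefficients of a polynomial in
    y can be read off the monomials of the formal sum ([horner_y_coef]). *)
Definition xonly : {pred gsum K} :=
  fun f => `[< forall q, gval f q != 0 -> q.2 = 0 >].

Lemma xonlyP f : reflect (forall q, gval f q != 0 -> q.2 = 0) (f \in xonly).
Proof. exact: asboolP. Qed.

Fact xonly_subring : subring_closed xonly.
Proof.
split.
- apply/xonlyP => q; rewrite gval1 /fone /fmono.
  by case: ifP => [/eqP->|]; rewrite ?eqxx.
- move=> f g /xonlyP xf /xonlyP xg; apply/xonlyP => q.
  rewrite raddfB /= fsumDE fsumNE; have [->|/xf //] := eqVneq (gval f q) 0.
  by rewrite sub0r oppr_eq0 => /xg.
- move=> f g /xonlyP xf /xonlyP xg; apply/xonlyP => q.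
  rewrite gvalM; apply: contra_neqP => q2; apply: fsbig1 => p _; apply/eqP.
  apply: contra_notT q2; rewrite mulf_eq0 negb_or => /andP[/xf p2 /xg].
  by rewrite /= p2 subr0.
Qed.
HB.instance Definition _ :=
  GRing.isSubringClosed.Build (gsum K) xonly xonly_subring.

Lemma gmono_xonly (c : K) (a : int) : gmono c a 0 \in xonly.
Proof.
by apply/xonlyP => q; rewrite /= /fmono; case: ifP => [/eqP->|]; rewrite ?eqxx.
Qed.

Lemma gpoly_xonly (p : {poly K}) : gpoly p \in xonly.
Proof.
rewrite gpolyE rpred_sum // => i _; rewrite rpredM ?rpredX //;
  exact: gmono_xonly.
Qed.

Lemma map_gpoly_xonly (F : {poly {poly K}}) :
  map_poly (@gpoly K) F \is a polyOver xonly.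
Proof. by apply/polyOverP => k; rewrite coef_map gpoly_xonly. Qed.

Lemma horner_y_coef (p : {poly gsum K}) (a : rat) (k : nat) :
  p \is a polyOver xonly -> gval p.[gy K] (a, k%:R) = gval p`_k (a, 0).
Proof.
move=> /polyOverP xp.
rewrite (horner_coef_wide _ (leq_maxl (size p) k.+1)) gval_sumE.
have km : (k < maxn (size p) k.+1)%N by rewrite leq_max ltnSn orbT.
rewrite (bigD1 (Ordinal km)) // gval_mul_yX big1 => [|i ik].
  by rewrite /= subrr addr0.
rewrite gval_mul_yX /=; apply/eqP; apply: contraNT ik => /(xonlyP _ (xp i)).
by move=> /= /eqP; rewrite subr_eq0 eqr_nat => /eqP ki; apply/eqP/val_inj.
Qed.

End XOnly.

(** * Puiseux series and geometric series *)

Lemma fseries_neq0 (K : fieldType) (T : nat -> fsum K) q :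
  fseries T q != 0 -> exists m, T m q != 0.
Proof.
apply: contra_neqP => none; apply: fsbig1 => m _; apply/eqP.
by apply: contra_notT none; exists m.
Qed.

Section PuiseuxSeries.
Variable K : fieldType.

Lemma puiseux_admissible (s : fsum K) : puiseux_infty s -> admissible s.
Proof.
move=> [l0 [n [c [n0 ->]]]]; exists n, `|l0|%N; split=> // q.
move=> /fseries_neq0 [l]; rewrite /fmono; case: ifP => [/eqP -> _|_ /eqP//].
exists (absz (`|l0|%N%:Z - l0 + l)), `|l0|%N; rewrite /grid_point subrr mul0r.
congr (_ / _, _); rewrite (natr_absz _ (_ - l0 + l)) ger0_norm; last by lia.
by rewrite !rmorphD rmorphN /= -!pmulrn; ring.
Qed.

Lemma puiseux_xonly (f : gsum K) : puiseux_infty f -> f \in @xonly K.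
Proof.
move=> [l0 [n [c [_ fE]]]]; apply/xonlyP => q; rewrite fE.
by move=> /fseries_neq0 [l]; rewrite /fmono; case: ifP => [/eqP ->|_ /eqP].
Qed.

Lemma admissible_geometric (z : K) :
  admissible (fseries (fun m => fmono (z ^+ m) (- m.+1%:R) 0)).
Proof.
exists 1, 0; split=> // q /fseries_neq0 [m]; rewrite /fmono.
case: ifP => [/eqP -> _|_ /eqP//]; exists m.+1, 0.
by rewrite /grid_point !divr1 sub0r subrr.
Qed.

(** 1 / (x - z), expanded at infinity. *)
Definition ginvx (z : K) : gsum K := mk_gsum (admissible_geometric z).

Lemma fseries_negpow_coef (T : nat -> K) m :
  fseries (fun m => fmono (T m) (- m.+1%:R) 0) (- m.+1%:R, 0) = T m.
Proof.
have E u : ((- m.+1%:R : rat, 0 : rat) == (- u.+1%:R, 0)) = (u == m).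
  by rewrite -pair_eqE /pair_eq /= eqxx andbT eqr_opp eqr_nat eqSS eq_sym.
rewrite /fseries (fsbigTE [fset m]%fset) => [|u].
  by rewrite big_seq_fset1 /fmono E eqxx.
by rewrite inE /fmono E => /negbTE ->.
Qed.

Lemma ginvx_coef z m : gval (ginvx z) (- m.+1%:R, 0) = z ^+ m.
Proof. exact: fseries_negpow_coef. Qed.

(** The coefficient of x^(-m-1) in x * ginvx z is z^(m+1), which z * ginvx z
    cancels; what is left is the constant term 1 of x * ginvx z. *)
Lemma ginvxP z : (gx K - gcst z) * ginvx z = 1.
Proof.
apply/gval_inj/funext => q; rewrite mulrBl raddfB /= fsumDE fsumNE.
rewrite !fmul_monol mul1r.
have coef m := fseries_negpow_coef (fun m => z ^+ m) m.
set S := fseries _ in coef *.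
have off p : (forall m, p != (- m.+1%:R, 0)) -> S p = 0.
  move=> pN; apply/eqP; apply: contraT => /fseries_neq0 [m].
  by rewrite /fmono (negbTE (pN m)) eqxx.
rewrite (_ : q - (0%:~R, 0%:~R) = q); last exact: subr0.
have [->|qN0] := eqVneq q (0, 0).
  rewrite /fone /fmono eqxx (off (0, 0)) => [|m]; last first.
    by rewrite -pair_eqE /pair_eq /= eqxx andbT eq_sym oppr_eq0 pnatr_eq0.
  by rewrite mulr0 subr0 -[RHS](coef 0); congr (S _); congr pair.
rewrite /fone /fmono (negbTE qN0).
have [[m ->]|none] := pselect (exists m : nat, q = (- m.+1%:R, 0)).
  rewrite coef -exprS -(coef m.+1); apply/eqP; rewrite subr_eq0; apply/eqP.
  congr (S _).
  by congr pair; rewrite ?subr0 // [in RHS]mulrSr opprD.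
rewrite (off q) => [|m]; last by apply/eqP => qE; apply: none; exists m.
rewrite mulr0 subr0; apply: off => m; apply: contra_not_neq none => qE.
have {}qE : q = (- m.+1%:R, 0) + (1, 0) by rewrite -qE subrK.
case: m qE => [|m] qE; last first.
  by exists m; rewrite qE; congr pair; rewrite /= ?addr0 // mulrSr; ring.
by case/eqP: qN0; rewrite qE; congr pair; rewrite /= ?addr0 ?addNr.
Qed.

Lemma gval_gcstM c (f : gsum K) q : gval (gcst c * f) q = c * gval f q.
Proof. by rewrite gvalM fmul_monol; congr (_ * gval f _); exact: subr0. Qed.

Lemma zeros_seriesE L (x : 'I_L -> K) (nu : 'I_L -> nat) :
  zeros_series x nu = gval (\sum_l gcst (nu l)%:R * ginvx (x l)).
Proof.
apply/funext => q; rewrite gval_sumE.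
under [RHS]eq_bigr do rewrite gval_gcstM.
have [[m ->]|none] := pselect (exists m : nat, q = (- m.+1%:R, 0)).
  under [RHS]eq_bigr do rewrite ginvx_coef.
  rewrite /zeros_series /fseries (fsbigTE [fset m]%fset) => [|u].
    rewrite big_seq_fset1 fsum_sumE.
    by apply: eq_bigr => l _; rewrite /fmono eqxx.
  rewrite inE fsum_sumE => um; rewrite big1 // => l _; rewrite /fmono.
  rewrite -pair_eqE /pair_eq /= eqxx andbT eqr_opp eqr_nat eqSS eq_sym.
  by rewrite (negbTE um).
have off (T : nat -> fsum K) : (forall m, T m q = 0) -> fseries T q = 0.
  by move=> T0; apply: fsbig1 => m _; apply: T0.
have qN m : (q == (- m.+1%:R, 0)) = false.
  by apply/eqP => qE; apply: none; exists m.
rewrite /zeros_series off => [|m]; last first.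
  by rewrite fsum_sumE big1 // => l _; rewrite /fmono qN.
by rewrite big1 // => l _; rewrite /= off ?mulr0 // => m; rewrite /fmono qN.
Qed.

End PuiseuxSeries.

(** * Logarithmic derivatives and synthetic division *)

(** A logarithmic derivative of f is any u with D f = u * rho f, which needs no
    division. The derivation may take values in another ring, along rho. *)
Section LogarithmicDerivative.
Variables (A : comPzRingType) (B : comPzRingType) (rho : {rmorphism A -> B}).
Variable D : A -> B.
Hypothesis DM : forall f g, D (f * g) = D f * rho g + rho f * D g.

Lemma logder1 : D 1 = 0.
Proof.
by apply: (addrI (D 1)); rewrite -{3}[1]mulr1 DM rmorph1 mulr1 mul1r addr0.
Qed.

Lemma logderM f g u v : D f = u * rho f -> D g = v * rho g ->
  D (f * g) = (u + v) * rho (f * g).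
Proof. by move=> Df Dg; rewrite DM Df Dg rmorphM; ring. Qed.

Lemma logderX f u n : D f = u * rho f -> D (f ^+ n) = n%:R * u * rho (f ^+ n).
Proof.
move=> Df; elim: n => [|n IHn]; first by rewrite logder1 !mul0r.
by rewrite exprS (logderM Df IHn) mulrS; ring.
Qed.

Lemma logder_prod (I : Type) (r : seq I) (f : I -> A) (u : I -> B) :
  (forall i, D (f i) = u i * rho (f i)) ->
  D (\prod_(i <- r) f i) = (\sum_(i <- r) u i) * rho (\prod_(i <- r) f i).
Proof.
move=> Df; elim: r => [|i r IHr]; first by rewrite !big_nil logder1 mul0r.
by rewrite !big_cons; apply: logderM.
Qed.

End LogarithmicDerivative.

(** The coefficients satisfy G_(i+1) = H_i - c H_(i+1), so the sum telescopes to
    H_k - c^M H_(k+M). *)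
Lemma synthetic_division_coef (A : comNzRingType) (G H : {poly A}) (c : A) k M :
  G = H * ('X - c%:P) -> (size H <= M)%N ->
  H`_k = \sum_(m < M) G`_(k + m).+1 * c ^+ m.
Proof.
move=> -> HM.
have tele n : \sum_(m < n) (H * ('X - c%:P))`_(k + m).+1 * c ^+ m =
    H`_k - H`_(k + n) * c ^+ n.
  elim: n => [|n IHn]; first by rewrite big_ord0 addn0 mulr1 subrr.
  rewrite big_ord_recr /= IHn mulrBr coefB coefMX coefMC /= addnS exprS; ring.
rewrite tele [H`_(k + M)]nth_default ?mul0r ?subr0 //.
by rewrite (leq_trans HM) ?leq_addl.
Qed.

(** * Derivatives of polynomials as formal sums *)

Section Derivatives.
Variable K : numFieldType.

Lemma gder_mono c (a b : int) :
  gder (gmono c a b : gsum K) = gmono (a%:~R * c) (a - 1) b.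
Proof.
apply/gval_inj/funext => q; rewrite /= /fdx /fmono.
have -> : ((q.1 + 1, q.2) == (a%:~R, b%:~R)) = (q == ((a - 1)%:~R, b%:~R)).
  by case: q => q1 q2; rewrite -!pair_eqE /pair_eq /= rmorphB /= eq_sym
    -subr_eq eq_sym.
by case: eqP => [->|_]; rewrite ?mulr0 //= rmorphB /= subrK ratr_int.
Qed.

Lemma gmono0 a b : gmono 0 a b = 0 :> gsum K.
Proof. by apply/gval_inj/funext => q; rewrite /= /fmono if_same. Qed.

Lemma gder_cst c : gder (gcst c : gsum K) = 0.
Proof. by rewrite gder_mono mul0r gmono0. Qed.

Lemma gder_x : gder (gx K) = 1.
Proof. by rewrite gder_mono mulr1; apply/gval_inj. Qed.

Lemma gder_y : gder (gy K) = 0.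
Proof. by rewrite gder_mono mul0r gmono0. Qed.

Lemma gder_gpoly (p : {poly K}) : gder (gpoly p) = gpoly p^`().
Proof.
elim/poly_ind: p => [|p c IHp]; first by rewrite deriv0 !raddf0.
rewrite derivD derivM derivX derivC addr0 mulr1 !raddfD /= !rmorphM /=.
by rewrite gderM IHp gpolyX gpolyC gder_x gder_cst mulr1 addr0.
Qed.

Lemma gder_geval_y (F : {poly {poly K}}) :
  gder (geval (gy K) F) = geval (gy K) (dx F).
Proof.
rewrite gevalE raddf_sum /geval /= /horner_eval.
rewrite (horner_coef_wide _ (leq_trans (size_poly _ _) (size_poly _ _))).
apply: eq_bigr => k _; rewrite coef_map coef_map_id0 ?deriv0 //= -gder_gpoly.
by rewrite gderM gyX gder_mono mul0r gmono0 mulr0 addr0.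
Qed.

End Derivatives.

(** * The logarithmic derivative of mu *)

Lemma poly_zeros_factor (K : closedFieldType) (mu : {poly K}) L
    (x : 'I_L -> K) (nu : 'I_L -> nat) :
  mu != 0 -> injective x -> (forall z, root mu z <-> exists l, z = x l) ->
  (forall l, nu l = mup (x l) mu) ->
  mu = (lead_coef mu)%:P * \prod_(l < L) ('X - (x l)%:P) ^+ nu l.
Proof.
move=> mu0 x_inj x_zeros nuE; have [r rE] := closed_field_poly_normal mu.
have lc0 : lead_coef mu != 0 by rewrite lead_coef_eq0.
have rootE z : root mu z = (z \in r) by rewrite rE rootZ // root_prod_XsubC.
have nu_count l : nu l = count_mem (x l) r.
  rewrite nuE {1}rE -mul_polyC mupMr ?mu_prod_XsubC //.
  by rewrite rootC.
rewrite {1}rE -mul_polyC; congr (_ * _).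
rewrite -prodr_undup_exp_count.
rewrite (perm_big [seq x l | l <- index_enum 'I_L]) /=; last first.
  apply: uniq_perm; rewrite ?undup_uniq ?map_inj_uniq ?index_enum_uniq //.
  move=> z; rewrite mem_undup -rootE; apply/idP/mapP => [/x_zeros [l ->]|].
    by exists l; rewrite ?mem_index_enum.
  by case=> l _ ->; apply/x_zeros; exists l.
by rewrite big_map; apply: eq_bigr => l _; rewrite nu_count.
Qed.

(** mu' / mu = \sum_l nu_l / (x - x_l). *)
Lemma gder_gpoly_zeros (K : numClosedFieldType) (mu : {poly K}) L
    (x : 'I_L -> K) (nu : 'I_L -> nat) :
  mu != 0 -> injective x -> (forall z, root mu z <-> exists l, z = x l) ->
  (forall l, nu l = mup (x l) mu) ->
  gder (gpoly mu) = (\sum_l gcst (nu l)%:R * ginvx (x l)) * gpoly mu.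
Proof.
move=> mu0 x_inj x_zeros nuE.
rewrite (poly_zeros_factor mu0 x_inj x_zeros nuE).
pose D p : gsum K := gder (gpoly p).
have DM p q : D (p * q) = D p * gpoly q + gpoly p * D q.
  by rewrite /D rmorphM gderM.
rewrite -/(D _) DM {1}/D gpolyC gder_cst mul0r add0r.
rewrite (@logder_prod _ _ (@gpoly K) D DM _ _ _
  (fun l => gcst (nu l)%:R * ginvx (x l))) => [|l].
  by rewrite [gpoly (_ * _)]rmorphM /= gpolyC mulrCA.
have linear : D ('X - (x l)%:P) = ginvx (x l) * gpoly ('X - (x l)%:P).
  rewrite /D rmorphB /= gpolyX gpolyC raddfB /= gder_x gder_cst subr0.
  by rewrite mulrC ginvxP.
by rewrite (logderX DM _ linear) rmorph_nat.
Qed.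

(** * The curve and its cofactor *)

Section Curve.
Variables (K : numClosedFieldType) (N : nat) (Y : 'I_N -> gsum K).
Hypothesis Y_xonly : forall j, Y j \in @xonly K.
Implicit Types (F P Q : {poly {poly K}}).

Definition branch_product (mu : {poly K}) : {poly gsum K} :=
  (gpoly mu)%:P * \prod_j ('X - (Y j)%:P).

Lemma gval_branch_product mu :
  gval (branch_product mu).[gy K] = puiseux_product mu (fun j => gval (Y j)).
Proof.
rewrite hornerM hornerC gvalM gval_gpoly; congr (fmul _ _).
rewrite horner_prod; elim/big_rec2: _ => // j V W _ <-.
by rewrite gvalM hornerXsubC.
Qed.

(** The projection determines the coefficients of F, and those of the product
    from y^N on are mu, 0, 0, ..., so the two polynomials differ by one
    of degree less than N in y. The difference vanishes at the N distinct
    branches. *)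
Lemma projection_factored F mu :
  injective Y -> (forall j, geval (Y j) F = 0) ->
  fpoly F = fplus (gval (branch_product mu).[gy K]) ->
  map_poly (@gpoly K) F = branch_product mu.
Proof.
move=> Y_inj Y_root F_form.
have sP : size (\prod_(j < N) ('X - (Y j)%:P)) = N.+1.
  by rewrite size_prod_XsubC [index_enum _]unlock -enumT size_enum_ord.
have mP : \prod_(j < N) ('X - (Y j)%:P) \is monic by apply: monic_prod_XsubC.
have xonly_f : branch_product mu \is a polyOver (@xonly K).
  rewrite rpredM ?polyOverC ?gpoly_xonly // rpred_prod // => j _.
  by rewrite polyOverXsubC Y_xonly.
have coefF k i : F`_k`_i = gval (branch_product mu)`_k (i%:R, 0).
  by rewrite -horner_y_coef // -fpoly_coef F_form /fplus /= !natr_nat.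
have topN : (branch_product mu)`_N = gpoly mu.
  by move/monicP: mP; rewrite coefCM lead_coefE sP /= => ->; rewrite mulr1.
have high k : (N < k)%N -> (branch_product mu)`_k = 0.
  by move=> Nk; rewrite coefCM nth_default ?mulr0 // sP.
have FN : F`_N = mu.
  by apply/polyP => i; rewrite coefF topN gval_gpoly (fpoly_coef _ i 0) coefC.
have Fhigh k : (N < k)%N -> F`_k = 0.
  by move=> Nk; apply/polyP => i; rewrite coefF high // coef0.
apply/eqP; rewrite -subr_eq0; apply/eqP.
apply: (@roots_geq_poly_eq0 _ _ [seq Y j | j <- enum 'I_N]).
- apply/allP => _ /mapP [j _ ->]; rewrite /root hornerD hornerN.
  have := Y_root j; rewrite /geval /= /horner_eval => ->.
  rewrite hornerM horner_prod (bigD1 j) //= hornerXsubC subrr mul0r.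
  by rewrite mulr0 subr0.
- by rewrite map_inj_uniq // enum_uniq.
- rewrite size_map size_enum_ord; apply/leq_sizeP => k.
  rewrite leq_eqVlt coefB coef_map /= => /predU1P [<-|Nk].
    by rewrite FN topN subrr.
  by rewrite Fhigh // high // rmorph0 subrr.
Qed.

(** The derivation P d/dx + Q d/dy. Its argument keeps y as an indeterminate
    over the formal sums, so that d/dy is formal, and is then evaluated at y. *)
Definition field_der P Q (p : {poly gsum K}) : gsum K :=
  geval (gy K) P * gder p.[gy K] + geval (gy K) Q * (p^`()).[gy K].

Lemma field_derM P Q p q :
  field_der P Q (p * q) =
  field_der P Q p * q.[gy K] + p.[gy K] * field_der P Q q.
Proof. by rewrite /field_der derivM hornerD !hornerM gderM; ring. Qed.

Lemma field_der_map P Q F :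
  field_der P Q (map_poly (@gpoly K) F) = geval (gy K) (P * dx F + Q * dy F).
Proof.
have evalE G : (map_poly (@gpoly K) G).[gy K] = geval (gy K) G by [].
by rewrite /field_der deriv_map !evalE gder_geval_y rmorphD !rmorphM.
Qed.

(** Q(x, y) - P(x, y) y_j'(x), as a polynomial in y; it vanishes at y = y_j
    exactly when y_j solves the differential equation. *)
Definition branch_residual P Q j : {poly gsum K} :=
  map_poly (@gpoly K) Q - map_poly (@gpoly K) P * (gder (Y j))%:P.

(** Z stands for mu' / mu and H j for (Q - P y_j') / (y - y_j): the logarithmic
    derivatives of the factors of F, which add up to that of F. *)
Lemma cofactor_expansion P Q F mu lam (Z : gsum K)
    (H : 'I_N -> {poly gsum K}) :
  F != 0 -> map_poly (@gpoly K) F = branch_product mu ->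
  gder (gpoly mu) = Z * gpoly mu ->
  (forall j, branch_residual P Q j = H j * ('X - (Y j)%:P)) ->
  is_cofactor P Q F lam ->
  geval (gy K) lam = geval (gy K) P * Z + \sum_j (H j).[gy K].
Proof.
move=> F0 FE muZ HE lamF.
have Fy : geval (gy K) F = (branch_product mu).[gy K] by rewrite -FE.
have F0' : (branch_product mu).[gy K] != 0.
  by rewrite -Fy -(rmorph0 (geval (gy K))) (inj_eq (@geval_y_inj K)).
apply: (mulIf F0').
have -> : geval (gy K) lam * (branch_product mu).[gy K] =
    field_der P Q (branch_product mu).
  by rewrite -FE field_der_map lamF rmorphM.
pose rho : {rmorphism {poly gsum K} -> gsum K} := horner_eval (gy K).
have DM : forall p q, field_der P Q (p * q) =
  field_der P Q p * rho q + rho p * field_der P Q q := @field_derM P Q.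
apply: (logderM (rho := rho) DM).
  by rewrite /field_der derivC horner0 mulr0 addr0 /= /horner_eval hornerC
    muZ mulrA.
apply: (logder_prod (rho := rho) DM) => j.
have Hy : (H j).[gy K] * (gy K - Y j) = (branch_residual P Q j).[gy K].
  by rewrite HE hornerM hornerXsubC.
rewrite /= /horner_eval hornerXsubC Hy /field_der derivXsubC hornerC mulr1.
rewrite hornerXsubC raddfB /= gder_y sub0r mulrN /branch_residual.
by rewrite !hornerE addrC.
Qed.

(** Dividing by y^(m+1) shifts coefficients, so the m-th term contributes
    G_(k+m+1) y_j^m to y^k, and these add up to the k-th coefficient of H j by
    synthetic division. *)
Lemma branches_seriesE P Q (H : 'I_N -> {poly gsum K}) (a : rat) (k : nat) :
  (forall j, branch_residual P Q j = H j * ('X - (Y j)%:P)) ->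
  branches_series P Q (fun j => gval (Y j)) (a, k%:R) =
  gval (\sum_j (H j).[gy K]) (a, k%:R).
Proof.
move=> HE; pose M := (\max_j size (H j))%N.
have HM (j : 'I_N) : (size (H j) <= M)%N.
  exact: (@leq_bigmax _ (fun j => size (H j))).
have xonly_d j : gder (Y j) \in @xonly K.
  apply/xonlyP => q; rewrite mulf_eq0 negb_or => /andP[_].
  by move=> /(xonlyP _ (Y_xonly j)).
have xonly_G j : branch_residual P Q j \is a polyOver (@xonly K).
  by rewrite rpredB ?rpredM ?polyOverC ?map_gpoly_xonly.
pose coef j m := gval ((branch_residual P Q j)`_(k + m).+1 * Y j ^+ m) (a, 0).
have term j m : fmul (fmul (fpoly Q - fmul (fpoly P) (fdx (gval (Y j))))
      (fpow (gval (Y j)) m)) (fmono 1 0 (- m.+1%:R)) (a, k%:R) = coef j m.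
  have -> : fpoly Q - fmul (fpoly P) (fdx (gval (Y j))) =
      gval (branch_residual P Q j).[gy K].
    rewrite /branch_residual hornerD hornerN hornerM hornerC raddfB /=.
    by rewrite -!gval_geval_y.
  rewrite -gvalX -gvalM fmulC fmul_monol mul1r.
  have -> : (branch_residual P Q j).[gy K] * Y j ^+ m =
      (branch_residual P Q j * (Y j ^+ m)%:P).[gy K].
    by rewrite hornerM hornerC.
  have -> : ((a, k%:R) - (0, - m.+1%:R) : rat * rat) = (a, (k + m).+1%:R).
    by congr pair; rewrite /= ?subr0 // opprK -natrD addnS.
  rewrite horner_y_coef ?coefMC // rpredM ?polyOverC ?rpredX //.
  exact: xonly_G.
have Hcoef (j : 'I_N) (i : nat) : (H j)`_i =
    \sum_(m < M) (branch_residual P Q j)`_(i + m).+1 * Y j ^+ m.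
  exact: synthetic_division_coef.
have H_xonly (j : 'I_N) : H j \is a polyOver (@xonly K).
  apply/polyOverP => i; rewrite Hcoef rpred_sum // => m _.
  by rewrite rpredM ?rpredX //; apply: (polyOverP (xonly_G j)).
(* From m = M on, the series has no monomials at y^k. *)
have vanish (j : 'I_N) (m : nat) : (M <= m)%N -> coef j m = 0.
  move=> Mm; have H0 i : (m <= i)%N -> (H j)`_i = 0.
    by move=> mi; rewrite nth_default // (leq_trans (HM j)) // (leq_trans Mm).
  have G0 : (branch_residual P Q j)`_(k + m).+1 = 0.
    rewrite HE mulrBr coefB coefMX coefMC /=.
    by rewrite !H0 ?mul0r ?subr0 ?leqW ?leq_addl.
  by rewrite /coef G0 mul0r.
rewrite gval_sumE /branches_series /fseries.
rewrite (fsbigE (iota 0 M)) ?iota_uniq // => [|m _]; last first.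
  rewrite mem_iota -leqNgt => Mm.
  by rewrite fsum_sumE big1 // => j _; rewrite term vanish.
rewrite (eq_bigl xpredT) => [|m]; last by rewrite in_setT.
under eq_bigr => m _ do
  [rewrite fsum_sumE; under eq_bigr => j _ do rewrite term].
rewrite exchange_big; apply: eq_bigr => j _ /=.
rewrite horner_y_coef // Hcoef gval_sumE.
by rewrite -(big_mkord xpredT (coef j)) /index_iota subn0.
Qed.

End Curve.

Theorem theorem2p2 (R : realType) (P Q F : {poly {poly R[i]}})
  (mu : {poly R[i]}) (N : nat) (y : 'I_N -> fsum R[i])
  (L : nat) (x : 'I_L -> R[i]) (nu : 'I_L -> nat)
  (lam : {poly {poly R[i]}})
  (PQ_prime : relatively_prime P Q)
  (F_y_neq0 : dy F <> 0)
  (F_inv : invariant_curve P Q F)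
  (F_irr : irreducible F)
  (y_puiseux : forall j, puiseux_infty (y j))
  (y_distinct : injective y)
  (y_ode : forall j, solves_ode P Q (y j))
  (* the y_j are the Puiseux branches of the curve F = 0 at x = infinity *)
  (y_root : forall j, fsubst F (y j) = 0)
  (F_form : fpoly F = fplus (puiseux_product mu y))
  (x_distinct : injective x)
  (x_zeros : forall z : R[i], root mu z <-> exists l, z = x l)
  (nu_mult : forall l, nu l = mup (x l) mu)
  (lam_cofactor : is_cofactor P Q F lam) :
  fpoly lam = fplus (fmul (fpoly P) (zeros_series x nu)
                     + branches_series P Q y)
  /\ (forall mu0 : R[i], mu = mu0%:P ->
        L = 0%N /\ fpoly lam = fplus (branches_series P Q y)).
Proof.
pose K : numClosedFieldType := R[i].
pose Y j : gsum K := mk_gsum (puiseux_admissible (y_puiseux j)).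
have Y_xonly j : Y j \in @xonly K.
  exact: puiseux_xonly (y_puiseux j : puiseux_infty (Y j)).
have Y_inj : injective Y.
  by move=> i j ij; apply/y_distinct/(congr1 (@gval K) ij).
have F0 : F != 0 by apply: contra_notN F_y_neq0 => /eqP ->; apply: deriv0.
have Y_root j : geval (Y j) F = 0.
  by apply: gval_inj; rewrite gval_geval; apply: y_root.
have F_form' : fpoly F =
    fplus (gval (branch_product Y (mu : {poly K})).[gy K]).
  by rewrite gval_branch_product.
have FE := projection_factored Y_xonly Y_inj Y_root F_form'.
have mu0 : mu != 0.
  apply: contraNneq F0 => mu0; apply/eqP/(@geval_y_inj K).
  rewrite /geval /= FE /branch_product mu0 !rmorph0 mul0r.
  by rewrite /horner_eval horner0.
have res_root j : exists H, branch_residual Y P Q j = H * ('X - (Y j)%:P).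
  apply/factor_theorem; rewrite /root /branch_residual hornerD hornerN hornerM.
  rewrite hornerC; apply/eqP/gval_inj.
  have := y_ode j; rewrite /solves_ode -!(gval_geval (Y j)) => /eqP.
  rewrite subr_eq0 => /eqP ode; rewrite raddfB /=.
  by apply/eqP; rewrite subr_eq0 eq_sym; apply/eqP.
have [H HE] := choice res_root.
have main : fpoly lam = fplus (fmul (fpoly P) (zeros_series x nu)
                               + branches_series P Q y).
  rewrite -fplus_fpoly; apply/funext => q; rewrite /fplus.
  case: ifP => // /andP[/natrP [i q1] /natrP [k q2]].
  have -> : q = (i%:R, k%:R) by rewrite -q1 -q2 -surjective_pairing.
  rewrite -(gval_geval_y (lam : {poly {poly K}})).
  have muZ := gder_gpoly_zeros mu0 x_distinct x_zeros nu_mult.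
  rewrite (cofactor_expansion F0 FE muZ HE lam_cofactor).
  rewrite gvalD !fsumDE -(branches_seriesE Y_xonly _ _ HE).
  by rewrite gvalM gval_geval_y -zeros_seriesE.
split=> // c muc; have L0 : L = 0%N.
  case: L x x_zeros {x_distinct nu nu_mult main} => // L x x_zeros.
  have /x_zeros : exists l, x ord0 = x l by exists ord0.
  move/rootP; rewrite muc hornerC => c0.
  by move/eqP: mu0; rewrite muc c0 polyC0.
split=> //; rewrite main; congr fplus.
have -> : zeros_series x nu = 0.
  apply/funext => q; apply: fsbig1 => m _; rewrite fsum_sumE big1 // => l.
  by exfalso; rewrite L0 in l; case: l.
have -> : fmul (fpoly P) 0 = 0 :> fsum K.
  by apply/funext => q; apply: fsbig1 => p _; apply: mulr0.
exact: add0r.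
Qed.
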